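(* For all positive integers $m,n$, let $K_2(m,n):=\max_{A\in\mathcal A(m,n)}\mathrm{Vdisc}_2(A)$. Then $$K_2(m,n)\le \max_{C\in\mathcal C(m,n)}\mathrm{cdisc}(C)\le 2\,K_2(2m,n).$$
   Context: $\mathcal A(m,n)$ is the set of matrices in $\mathbb R^{m\times n}$ all of whose columns have Euclidean norm at most $1$ (real Koml\'os matrices); $\mathcal C(m,n)$ is the set of matrices in $\mathbb C^{m\times n}$ all of whose columns have $\ell_2$ norm at most $1$ (complex Koml\'os matrices). For $C\in\mathbb C^{m\times n}$, $\mathrm{cdisc}(C):=\min_{z\in\mathbb T^n}\|Cz\|_\infty$, where $\mathbb T^n$ is the set of vectors in $\mathbb C^n$ all of whose entries have modulus $1$ and $\|w\|_\infty=\max_i|w_i|$. For $A\in\mathbb R^{m\times n}$, the rank-2 vector discrepancy is $\mathrm{Vdisc}_2(A):=\min_{u_1,\dots,u_n\in\mathbb S^1}\max_{1\le i\le m}\big|\sum_{j=1}^n A_{ij}u_j\big|$, where $\mathbb S^1$ is the unit circle in $\mathbb R^2$ and $|\cdot|$ is the Euclidean norm on $\mathbb R^2$. *)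

(* Defs.v *)
From HB Require Import structures.
From mathcomp Require Import all_boot all_order all_algebra.
From mathcomp Require Import all_classical all_reals.
From mathcomp Require Export complex.

Set Implicit Arguments.
Unset Strict Implicit.
Unset Printing Implicit Defensive.

Import Order.TTheory GRing.Theory Num.Theory.

Local Open Scope classical_set_scope.
Local Open Scope ring_scope.

(* [normc : R[i] -> R] is the real-valued modulus; the canonical norm [`|z|]
   of [R[i]] takes its values in [R[i]] itself. *)
Notation cmod := ComplexField.Normc.normc.

Definition is_min (R : realType) (S : set R) (x : R) : Prop :=
  S x /\ lbound S x.

Definition is_max (R : realType) (S : set R) (x : R) : Prop :=
  S x /\ ubound S x.

(* The norm [`|v|] that MathComp-Analysis puts on matrices is the sup norm,
   hence the explicit Euclidean norms. *)
Definition l2norm (R : realType) (k : nat) (v : 'cV[R]_k) : R :=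
  Num.sqrt (\sum_(i < k) v i 0 ^+ 2).

Definition cl2norm (R : realType) (k : nat) (v : 'cV[R[i]]_k) : R :=
  Num.sqrt (\sum_(i < k) cmod (v i 0) ^+ 2).

Definition clinfnorm (R : realType) (k : nat) (w : 'cV[R[i]]_k) : R :=
  \big[Num.max/0]_(i < k) cmod (w i 0).

Definition komlos (R : realType) (m n : nat) : set 'M[R]_(m, n) :=
  [set A | forall j, l2norm (col j A) <= 1].

Definition ckomlos (R : realType) (m n : nat) : set 'M[R[i]]_(m, n) :=
  [set C | forall j, cl2norm (col j C) <= 1].

Definition circle (R : realType) : set 'cV[R]_2 := [set u | l2norm u = 1].

Definition torus (R : realType) (n : nat) : set 'cV[R[i]]_n :=
  [set z | forall j, cmod (z j 0) = 1].

Definition Vdisc2_values (R : realType) (m n : nat) (A : 'M[R]_(m, n)) :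
    set R :=
  [set \big[Num.max/0]_(i < m) l2norm (\sum_(j < n) A i j *: u j)
    | u in [set u : 'I_n -> 'cV[R]_2 | forall j, circle (u j)]].

Definition cdisc_values (R : realType) (m n : nat) (C : 'M[R[i]]_(m, n)) :
    set R :=
  [set clinfnorm (C *m z) | z in @torus R n].

(* [inf] and [sup] are total; that the four optima below are attained, i.e.
   are genuine minima and maxima, is part of the theorem. *)
Definition Vdisc2 (R : realType) (m n : nat) (A : 'M[R]_(m, n)) : R :=
  inf (Vdisc2_values A).

Definition cdisc (R : realType) (m n : nat) (C : 'M[R[i]]_(m, n)) : R :=
  inf (cdisc_values C).

Definition K2_values (R : realType) (m n : nat) : set R :=
  [set Vdisc2 A | A in @komlos R m n].

Definition Kc_values (R : realType) (m n : nat) : set R :=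
  [set cdisc C | C in @ckomlos R m n].

Arguments K2_values : clear implicits.
Arguments Kc_values : clear implicits.

Definition K2 (R : realType) (m n : nat) : R := sup (K2_values R m n).

Definition Kc (R : realType) (m n : nat) : R := sup (Kc_values R m n).

(* Main.v *)
Require Import Defs.
From HB Require Import structures.
From mathcomp Require Import all_boot all_order all_algebra.
From mathcomp Require Import all_classical all_reals.
From mathcomp Require Import topology normedtype derive lra.

(* Identifying the circle in the plane with the unimodular complex numbers,
   the rank-2 vector discrepancy of a real matrix is its complex discrepancy,
   which gives the first inequality.  For the second, stack X over Y for an
   extremal C = X + iY: the columns keep their norms, and Cz = Xz + i(Yz) has
   entries at most twice the largest entry of the stacked product.
   The optima are attained because the torus and the sets of Komlos matrices
   are compact, z |-> |Cz| is Lipschitz, and so is cdisc, being an infimum of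
   functions of C with a common Lipschitz constant. *)

Import Order.TTheory GRing.Theory Num.Theory.
Import numFieldNormedType.Exports.
Local Open Scope ring_scope.

Section ComplexKomlos.
Set Implicit Arguments.
Unset Strict Implicit.
Variable R : realType.

(** * The modulus of a complex number and its real and imaginary parts *)

Lemma cmodE (x y : R) : cmod (Complex x y) = Num.sqrt (x ^+ 2 + y ^+ 2).
Proof. by []. Qed.

Lemma cmod_ge0 (a : R[i]) : 0 <= cmod a.
Proof. by case: a => x y; rewrite cmodE sqrtr_ge0. Qed.

Lemma sqr_cmod (a : R[i]) : cmod a ^+ 2 = complex.Re a ^+ 2 + complex.Im a ^+ 2.
Proof. by case: a => x y; rewrite cmodE sqr_sqrtr// addr_ge0 ?sqr_ge0. Qed.

Lemma cmod0 : cmod (0 : R[i]) = 0.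
Proof. exact: ComplexField.Normc.normc0. Qed.

Lemma cmodM (a b : R[i]) : cmod (a * b) = cmod a * cmod b.
Proof. exact: ComplexField.Normc.normcM. Qed.

Lemma cmodN (a : R[i]) : cmod (- a) = cmod a.
Proof. by case: a => x y; rewrite !cmodE !sqrrN. Qed.

Lemma ler_cmodD (a b : R[i]) : cmod (a + b) <= cmod a + cmod b.
Proof. exact: complex.le_normcD. Qed.

Lemma ler_cmod_sum (I : finType) (F : I -> R[i]) :
  cmod (\sum_i F i) <= \sum_i cmod (F i).
Proof.
elim/big_ind2 : _ => [|a x b y ax bx|//]; first by rewrite cmod0.
by rewrite (le_trans (ler_cmodD _ _))// lerD.
Qed.

Lemma ler_dist_cmod (a b : R[i]) : `|cmod a - cmod b| <= cmod (a - b).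
Proof.
have h := ler_cmodD (a - b) b; rewrite subrK in h.
have k := ler_cmodD (b - a) a; rewrite subrK -(cmodN (_ - _)) opprB in k.
by rewrite ler_norml; apply/andP; split; lra.
Qed.

(** The square of the right-hand side exceeds that of the modulus by twice the product of the
    absolute values. *)
Lemma ler_cmod_ReIm (a : R[i]) : cmod a <= `|complex.Re a| + `|complex.Im a|.
Proof.
case: a => x y; rewrite cmodE -[leRHS]ger0_norm ?addr_ge0//.
rewrite -sqrtr_sqr ler_sqrt ?sqr_ge0//=.
rewrite -(real_normK (num_real x)) -(real_normK (num_real y)).
have := normr_ge0 x; have := normr_ge0 y; nra.
Qed.

Lemma ler_Re_cmod (a : R[i]) : `|complex.Re a| <= cmod a.
Proof.
case: a => x y; rewrite cmodE -sqrtr_sqr ler_sqrt ?addr_ge0 ?sqr_ge0//.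
by rewrite lerDl sqr_ge0.
Qed.

Lemma ler_Im_cmod (a : R[i]) : `|complex.Im a| <= cmod a.
Proof.
case: a => x y; rewrite cmodE -sqrtr_sqr ler_sqrt ?addr_ge0 ?sqr_ge0//.
by rewrite lerDr sqr_ge0.
Qed.

(** * The entrywise l1 norm and the sup norm *)

Definition l1norm m n (C : 'M[R[i]]_(m, n)) : R := \sum_i \sum_j cmod (C i j).

Lemma l1norm_ge0 m n (C : 'M[R[i]]_(m, n)) : 0 <= l1norm C.
Proof. by do 2!apply: sumr_ge0 => ? _; exact: cmod_ge0. Qed.

Lemma ler_entry_l1norm m n (C : 'M[R[i]]_(m, n)) i j : cmod (C i j) <= l1norm C.
Proof.
rewrite /l1norm (bigD1 i)//= (bigD1 j)//= -addrA lerDl addr_ge0//.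
  by apply: sumr_ge0 => ? _; exact: cmod_ge0.
by do 2!apply: sumr_ge0 => ? _; exact: cmod_ge0.
Qed.

(** Expanding the right-hand side gives a sum over two inner indices; the triangle inequality bounds
    the left-hand side by the terms where they agree, and the others are nonnegative. *)
Lemma l1normM m n p (C : 'M[R[i]]_(m, n)) (D : 'M[R[i]]_(n, p)) :
  l1norm (C *m D) <= l1norm C * l1norm D.
Proof.
rewrite /l1norm mulr_suml; apply: ler_sum => i _.
apply: (@le_trans _ _ (\sum_k \sum_j cmod (C i j) * cmod (D j k))).
  apply: ler_sum => k _; rewrite mxE (le_trans (ler_cmod_sum _))//.
  by apply: ler_sum => j _; rewrite cmodM.
rewrite exchange_big/= mulr_suml; apply: ler_sum => j _.
rewrite -mulr_sumr ler_wpM2l ?cmod_ge0//.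
rewrite [leRHS](bigD1 j)//= lerDl.
by do 2!apply: sumr_ge0 => ? _; exact: cmod_ge0.
Qed.

Lemma l1norm_distC m n (C D : 'M[R[i]]_(m, n)) :
  l1norm (C - D) = l1norm (D - C).
Proof.
by apply: eq_bigr => i _; apply: eq_bigr => j _; rewrite !mxE -cmodN opprB.
Qed.

Lemma clinfnorm_ge0 k (w : 'cV[R[i]]_k) : 0 <= clinfnorm w.
Proof. exact: bigmax_ge_id. Qed.

Lemma ler_clinfnorm k (w : 'cV[R[i]]_k) i : cmod (w i 0) <= clinfnorm w.
Proof. exact: le_bigmax. Qed.

Lemma clinfnorm_leP k (w : 'cV[R[i]]_k) x : 0 <= x ->
  (forall i, cmod (w i 0) <= x) -> clinfnorm w <= x.
Proof. by move=> x0 h; apply: bigmax_le. Qed.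

(** One half of the sup norm being 1-Lipschitz for [l1norm]; the other half follows by exchanging
    [v] and [w]. *)
Lemma ler_clinfnorm_l1norm k (v w : 'cV[R[i]]_k) :
  clinfnorm v <= clinfnorm w + l1norm (v - w).
Proof.
apply: clinfnorm_leP => [|i]; first
  by rewrite addr_ge0 ?clinfnorm_ge0 ?l1norm_ge0.
rewrite -[v i 0](subrK (w i 0)) addrC (le_trans (ler_cmodD _ _))// lerD//.
  exact: ler_clinfnorm.
by have := ler_entry_l1norm (v - w) i 0; rewrite !mxE.
Qed.

(** * Continuity and compactness in real coordinates *)

(* Compactness is taken from Tychonoff's theorem: a complex matrix is encoded
   by the family of its real ([true]) and imaginary ([false]) coordinates. *)
Definition coords m n : topologicalType :=
  prod_topology (fun _ : 'I_m * 'I_n * bool => R : topologicalType).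

Definition mx_of_coords m n (x : coords m n) : 'M[R[i]]_(m, n) :=
  \matrix_(i, j) Complex (x (i, j, true)) (x (i, j, false)).

Definition coords_of_mx m n (C : 'M[R[i]]_(m, n)) : coords m n :=
  fun k => let: (i, j, b) := k in
    if b then complex.Re (C i j) else complex.Im (C i j).

Lemma coords_of_mxK m n : cancel (@coords_of_mx m n) (@mx_of_coords m n).
Proof. by move=> C; apply/matrixP => i j; rewrite mxE /=; case: (C i j). Qed.

Lemma coord_continuous m n k :
  continuous (fun x : coords m n => x k).
Proof. exact: (@proj_continuous _ (fun=> R) k). Qed.

Lemma sum_continuous (T : topologicalType) (I : finType) (f : I -> T -> R) :
  (forall i, continuous (f i)) -> continuous (fun x => \sum_i f i x).
Proof.
by move=> fc; apply: continuous_big => [|i _]; [exact: add_continuous|].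
Qed.

Lemma dominated_cvg (T : topologicalType) (f d : T -> R) (K : R) (x : T) :
  (forall y, `|f y - f x| <= K * d y) -> d x = 0 ->
  {for x, continuous d} -> {for x, continuous f}.
Proof.
move=> fd dx dc.
(* [K] has no prescribed sign, so a positive constant above it is used for the division by it. *)
have L0 : 0 < `|K| + 1 by rewrite ltr_wpDl.
apply/cvgrPdist_le => e e0; near=> y.
rewrite distrC (le_trans (fd y))// (le_trans (ler_norm _))// normrM.
rewrite (@le_trans _ _ ((`|K| + 1) * `|d y|))//.
  by rewrite ler_wpM2r// lerDl.
rewrite -ler_pdivlMl// mulrC.
near: y; have /cvgrPdist_le/(_ _ (divr_gt0 e0 L0)) := dc; rewrite dx.
by apply: filterS => y; rewrite sub0r normrN.
Unshelve. all: by end_near. Qed.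

(** The l1 distance is at most the finite sum [d] of the coordinate distances to [x], which is
    continuous in the product topology and vanishes at [x]. *)
Lemma lipschitz_coords_continuous m n (g : 'M[R[i]]_(m, n) -> R) (L : R) :
  0 <= L -> (forall C D, `|g C - g D| <= L * l1norm (C - D)) ->
  continuous (g \o @mx_of_coords m n).
Proof.
move=> L0 gL x.
pose d (y : coords m n) : R :=
  \sum_i \sum_j (`|y (i, j, true) - x (i, j, true)| +
                 `|y (i, j, false) - x (i, j, false)|).
have dx : d x = 0.
  rewrite /d big1// => i _; rewrite big1// => j _.
  by rewrite !subrr normr0 addr0.
have coordB k : continuous (fun y : coords m n => `|y k - x k|).
  move=> y.
  have h : ((y k - x k) @[y --> y] --> y k - x k)%classic.
    exact: (cvgB (@coord_continuous m n k y) (cvg_cst (x k))).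
  exact: (cvg_norm h).
have dc : continuous d.
  apply: (@sum_continuous (coords m n) _ (fun i y =>
    \sum_j (`|y (i, j, true) - x (i, j, true)| +
            `|y (i, j, false) - x (i, j, false)|))) => i.
  apply: (@sum_continuous (coords m n) _ (fun j y =>
    (`|y (i, j, true) - x (i, j, true)| +
     `|y (i, j, false) - x (i, j, false)|))) => j y.
  exact: (cvgD (coordB _ y) (coordB _ y)).
apply: (@dominated_cvg (coords m n) _ d L x _ dx (dc x)) => y.
rewrite (le_trans (gL _ _))// ler_wpM2l//.
apply: ler_sum => i _; apply: ler_sum => j _.
by rewrite !mxE (le_trans (ler_cmod_ReIm _)).
Qed.

(** Entries of modulus at most 1 have coordinates in [-1, 1], so [B] corresponds to a closed subset
    of a compact cube, where the continuous [g] attains its maximum. *)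
Lemma mx_EVT_max m n (B : set 'M[R[i]]_(m, n))
    (g : 'M[R[i]]_(m, n) -> R) (L : R) :
  (exists C, B C) ->
  closed (@mx_of_coords m n @^-1` B)%classic ->
  (forall C, B C -> forall i j, cmod (C i j) <= 1) ->
  0 <= L -> (forall C D, `|g C - g D| <= L * l1norm (C - D)) ->
  exists2 C, B C & forall D, B D -> g D <= g C.
Proof.
move=> [C0 BC0] clB B1 L0 gL.
pose cube : set (coords m n) :=
  [set x | forall k, `[-1, 1]%classic (x k)]%classic.
have cB : compact (@mx_of_coords m n @^-1` B)%classic.
  apply: (@subclosed_compact _ _ cube clB).
    exact: (@tychonoff _ (fun=> R : topologicalType)
      (fun=> `[-1, 1]%classic) (fun=> @segment_compact _ _ _)).
  move=> x Bx [[i j] b] /=; rewrite in_itv/= -ler_norml.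
  have := B1 _ Bx i j; rewrite mxE; apply: le_trans.
  by case: b;
    [exact: (ler_Re_cmod (Complex _ _))|exact: (ler_Im_cmod (Complex _ _))].
have B0 : (@mx_of_coords m n @^-1` B !=set0)%classic.
  by exists (coords_of_mx C0); rewrite /preimage/= coords_of_mxK.
have gc := lipschitz_coords_continuous L0 gL.
have [x Bx gx] := compact_EVT_max B0 cB (continuous_subspaceT gc).
exists (mx_of_coords x); first exact: set_mem Bx.
move=> D BD; rewrite -(coords_of_mxK D); apply: gx.
by rewrite inE /preimage/= coords_of_mxK.
Qed.

(** Once some element is known to be a minimum, the total function [inf] must return it. *)
Lemma is_min_inf (S : set R) x : is_min S x -> is_min S (inf S).
Proof.
move=> [Sx xS]; suff -> : inf S = x by [].
apply/eqP; rewrite eq_le ge_inf//=; last by exists x.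
by apply: lb_le_inf => //; exists x.
Qed.

Lemma is_max_sup (S : set R) x : is_max S x -> is_max S (sup S).
Proof.
move=> [Sx xS]; suff -> : sup S = x by [].
apply/eqP; rewrite eq_le ub_le_sup ?andbT//; last by exists x.
by apply: ge_sup => //; exists x.
Qed.

(** * Closedness of the torus and of the set of complex Komlós matrices *)

Lemma entry_cmod_continuous m n (i : 'I_m) (j : 'I_n) :
  continuous (fun x : coords m n => cmod (mx_of_coords x i j)).
Proof.
apply: (@lipschitz_coords_continuous _ _ (fun C => cmod (C i j)) 1) => // C D.
rewrite mul1r (le_trans (ler_dist_cmod _ _))//.
by have := ler_entry_l1norm (C - D) i j; rewrite !mxE.
Qed.

Lemma closed_forall (T : topologicalType) (K : Type) (P : K -> T -> Prop) :
  (forall i, closed [set x | P i x]%classic) ->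
  closed [set x | forall i, P i x]%classic.
Proof.
move=> h; rewrite (_ : mkset _ = \bigcap_i [set x | P i x])%classic.
  exact: closed_bigI.
by apply/seteqP; split=> x /= hx i; [move=> _; exact: hx|exact: hx].
Qed.

Lemma torus_closed n : closed (@mx_of_coords n 1 @^-1` @torus R n)%classic.
Proof.
apply: (@closed_forall (coords n 1)) => j.
exact: ((continuous_closedP _).1 (@entry_cmod_continuous n 1 j 0) _
  (@closed_eq R 1)).
Qed.

(** Without the square root, the constraint is a bound on a finite sum of continuous functions. *)
Lemma ckomlosE m n (C : 'M[R[i]]_(m, n)) :
  ckomlos C <-> forall j, \sum_i cmod (C i j) ^+ 2 <= 1.
Proof.
have h j : (cl2norm (col j C) <= 1) = (\sum_i cmod (C i j) ^+ 2 <= 1).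
  rewrite /cl2norm -[X in _ <= X]sqrtr1 ler_sqrt//.
  by congr (_ <= _); apply: eq_bigr => i _; rewrite mxE.
by split=> hC j; [rewrite -h; exact: hC|rewrite h].
Qed.

Lemma komlosE m n (A : 'M[R]_(m, n)) :
  komlos A <-> forall j, \sum_i A i j ^+ 2 <= 1.
Proof.
have h j : (l2norm (col j A) <= 1) = (\sum_i A i j ^+ 2 <= 1).
  rewrite /l2norm -[X in _ <= X]sqrtr1 ler_sqrt//.
  by congr (_ <= _); apply: eq_bigr => i _; rewrite mxE.
by split=> hA j; [rewrite -h; exact: hA|rewrite h].
Qed.

Lemma ckomlos_closed m n :
  closed (@mx_of_coords m n @^-1` @ckomlos R m n)%classic.
Proof.
rewrite (_ : (_ @^-1` _)%classic =
  [set x : coords m n |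
    forall j, \sum_i cmod (mx_of_coords x i j) ^+ 2 <= 1]%classic);
  last by apply/funext => x; apply/propext; exact: ckomlosE.
apply: (@closed_forall (coords m n)) => j.
apply: ((continuous_closedP (fun x : coords m n =>
  \sum_i cmod (mx_of_coords x i j) ^+ 2)).1 _ _ (@closed_le R 1)).
apply: sum_continuous => i x; rewrite /continuous_at expr2.
have h := @entry_cmod_continuous m n i j x.
exact: (cvgM h h).
Qed.

Lemma ckomlos_entry m n (C : 'M[R[i]]_(m, n)) i j :
  ckomlos C -> cmod (C i j) <= 1.
Proof.
move=> /ckomlosE/(_ j) h.
rewrite -(@ler_pXn2r _ 2)// ?nnegrE ?cmod_ge0// expr1n (le_trans _ h)//.
by rewrite (bigD1 i)//= lerDl sumr_ge0// => k _; rewrite sqr_ge0.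
Qed.

Lemma ckomlos0 m n : ckomlos (0 : 'M[R[i]]_(m, n)).
Proof.
by apply/ckomlosE => j; rewrite big1// => i _; rewrite mxE cmod0 expr0n.
Qed.

(** * Attainment of the complex discrepancy and of its maximum *)

Lemma l1norm_torus n (z : 'cV[R[i]]_n) : torus z -> l1norm z = n%:R.
Proof.
move=> hz; rewrite /l1norm; under eq_bigr do rewrite big_ord1 hz.
by rewrite sumr_const card_ord.
Qed.

(** The negated objective is maximised over the torus; it is Lipschitz in [z] with constant
    [l1norm C]. *)
Lemma cdisc_is_min m n (C : 'M[R[i]]_(m, n)) :
  is_min (cdisc_values C) (cdisc C).
Proof.
have [||||C0 D|z hz zmin] := @mx_EVT_max n 1 (@torus R n)
  (fun z => - clinfnorm (C *m z)) (l1norm C).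
- by exists (const_mx 1) => j; rewrite mxE ComplexField.Normc.normc1.
- exact: torus_closed.
- by move=> z hz i j; rewrite ord1 hz.
- exact: l1norm_ge0.
- have h (v w : 'cV_n) :
      clinfnorm (C *m v) <= clinfnorm (C *m w) + l1norm C * l1norm (v - w).
    rewrite (le_trans (ler_clinfnorm_l1norm _ (C *m w)))// lerD2l -mulmxBr.
    exact: l1normM.
  have := h C0 D; have := h D C0; rewrite (l1norm_distC D C0) => h1 h2.
  by rewrite ler_norml; apply/andP; split; lra.
apply: (@is_min_inf _ (clinfnorm (C *m z))); split; first by exists z.
by move=> _ [w hw <-]; have := zmin _ hw; rewrite lerN2.
Qed.

Lemma ler_cdisc m n (C : 'M[R[i]]_(m, n)) z :
  torus z -> cdisc C <= clinfnorm (C *m z).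
Proof. by move=> hz; apply: (cdisc_is_min C).2; exists z. Qed.

Lemma cdisc_attained m n (C : 'M[R[i]]_(m, n)) :
  exists2 z, torus z & cdisc C = clinfnorm (C *m z).
Proof. by have [[z hz <-] _] := cdisc_is_min C; exists z. Qed.

(** An optimal torus vector for one matrix is tested on the other. The two products differ by at
    most the l1 norm of the matrix difference times that of the vector, which is [n]. *)
Lemma cdisc_lipschitz m n (C D : 'M[R[i]]_(m, n)) :
  `|cdisc C - cdisc D| <= n%:R * l1norm (C - D).
Proof.
have h (A B : 'M[R[i]]_(m, n)) : cdisc A <= cdisc B + n%:R * l1norm (A - B).
  have [z hz ->] := cdisc_attained B.
  rewrite (le_trans (ler_cdisc _ hz))//.
  rewrite (le_trans (ler_clinfnorm_l1norm _ (B *m z)))//.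
  by rewrite lerD2l -mulmxBl (le_trans (l1normM _ _))// l1norm_torus// mulrC.
have := h C D; have := h D C; rewrite (l1norm_distC D C) => h1 h2.
by rewrite ler_norml; apply/andP; split; lra.
Qed.

Lemma Kc_is_max m n : is_max (Kc_values R m n) (Kc R m n).
Proof.
have [|||||C hC Cmax] := @mx_EVT_max m n (@ckomlos R m n) (@cdisc R m n) n%:R.
- by exists 0; exact: ckomlos0.
- exact: ckomlos_closed.
- by move=> C hC i j; exact: ckomlos_entry.
- exact: ler0n.
- exact: cdisc_lipschitz.
apply: (@is_max_sup _ (cdisc C)); split; first by exists C.
by move=> _ [D hD <-]; exact: Cmax.
Qed.

(** * Real matrices inside the complex ones *)

Definition realmx m n (A : 'M[R]_(m, n)) : 'M[R[i]]_(m, n) :=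
  map_mx (real_complex R) A.

Lemma realmx_komlos m n (A : 'M[R]_(m, n)) : ckomlos (realmx A) <-> komlos A.
Proof.
have h j : \sum_i cmod (realmx A i j) ^+ 2 = \sum_i A i j ^+ 2.
  by apply: eq_bigr => i _; rewrite sqr_cmod mxE /= expr0n addr0.
by rewrite ckomlosE komlosE; split=> hA j; have := hA j; rewrite h.
Qed.

Lemma l2norm2E (u : 'cV[R]_2) : l2norm u = cmod (Complex (u 0 0) (u 1 0)).
Proof.
rewrite cmodE /l2norm big_ord_recl big_ord_recl big_ord0 addr0.
by congr (Num.sqrt (_ + u _ 0 ^+ 2)); apply: val_inj.
Qed.

Lemma sum_Complex (I : finType) (x y : I -> R) :
  \sum_i Complex (x i) (y i) = Complex (\sum_i x i) (\sum_i y i).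
Proof.
elim: (index_enum I) => [|i r IHr]; first by rewrite !big_nil.
by rewrite !big_cons IHr.
Qed.

Lemma realmx_mulE m n (A : 'M[R]_(m, n)) (x y : 'I_n -> R) i :
  (realmx A *m (\col_j Complex (x j) (y j))) i 0 =
  Complex (\sum_j A i j * x j) (\sum_j A i j * y j).
Proof.
rewrite mxE -sum_Complex; apply: eq_bigr => j _.
by rewrite !mxE /real_complex_def; simpc.
Qed.

Lemma Vdisc2_valuesE m n (A : 'M[R]_(m, n)) :
  Vdisc2_values A = cdisc_values (realmx A).
Proof.
have h (u : 'I_n -> 'cV[R]_2) :
    \big[Num.max/0]_(i < m) l2norm (\sum_(j < n) A i j *: u j) =
    clinfnorm (realmx A *m \col_j Complex (u j 0 0) (u j 1 0)).
  apply: eq_bigr => i _; rewrite realmx_mulE l2norm2E.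
  by rewrite !summxE; congr (cmod (Complex _ _));
    apply: eq_bigr => j _; rewrite mxE.
apply/seteqP; split=> _ [/= u hu <-].
  exists (\col_j Complex (u j 0 0) (u j 1 0)); last by rewrite h.
  by move=> j; rewrite mxE -l2norm2E; exact: hu.
(* The inverse identification: each unimodular entry becomes a point of the circle. *)
pose v j : 'cV[R]_2 :=
  \col_k (if k == 0 then complex.Re (u j 0) else complex.Im (u j 0)).
have vE j : Complex (v j 0 0) (v j 1 0) = u j 0
  by rewrite !mxE/=; case: (u j 0).
exists v => [j|]; first by rewrite /circle/= l2norm2E vE; exact: hu.
by rewrite h; congr (clinfnorm (_ *m _)); apply/colP => j; rewrite mxE vE.
Qed.

Lemma Vdisc2E m n (A : 'M[R]_(m, n)) : Vdisc2 A = cdisc (realmx A).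
Proof. by rewrite /Vdisc2 Vdisc2_valuesE. Qed.

Lemma Vdisc2_is_min m n (A : 'M[R]_(m, n)) :
  is_min (Vdisc2_values A) (Vdisc2 A).
Proof. by rewrite Vdisc2E Vdisc2_valuesE; exact: cdisc_is_min. Qed.

(** Real Komlós matrices are treated as the complex ones with zero imaginary parts, a closed
    condition, so the same compactness argument applies to [cdisc]. *)
Lemma K2_is_max m n : is_max (K2_values R m n) (K2 R m n).
Proof.
pose B : set 'M[R[i]]_(m, n) :=
  [set C | ckomlos C /\ forall ij, complex.Im (C ij.1 ij.2) = 0]%classic.
have [|||||C [hC C0] Cmax] := @mx_EVT_max m n B (@cdisc R m n) n%:R.
- by exists 0; split=> [|ij]; [exact: ckomlos0|rewrite mxE].
- apply: closedI; first exact: ckomlos_closed.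
  apply: (@closed_forall (coords m n)) => ij.
  rewrite (_ : mkset _ = [set x : coords m n | x (ij, false) = 0]%classic).
    exact: ((continuous_closedP _).1 (@coord_continuous m n (ij, false)) _
      (@closed_eq R 0)).
  by apply/seteqP; split=> x /=; rewrite mxE -surjective_pairing.
- by move=> C [hC _] i j; exact: ckomlos_entry.
- exact: ler0n.
- exact: cdisc_lipschitz.
(* The maximiser found in [B] is the embedding of its own real part, hence comes from a real
   matrix. *)
have CE : realmx (map_mx (@complex.Re R) C) = C.
  apply/matrixP => i j; rewrite !mxE; have := C0 (i, j) => /=.
  by case: (C i j) => x y /= ->.
apply: (@is_max_sup _ (cdisc C)); split.
  exists (map_mx (@complex.Re R) C); last by rewrite Vdisc2E CE.
  by apply/realmx_komlos; rewrite CE.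
move=> _ [A hA <-]; rewrite Vdisc2E; apply: Cmax; split.
  exact/realmx_komlos.
by move=> ij; rewrite mxE.
Qed.

(** * The two inequalities *)

Lemma ler_K2_Kc m n : K2 R m n <= Kc R m n.
Proof.
have [[A hA <-] _] := K2_is_max m n; rewrite Vdisc2E.
by apply: (Kc_is_max m n).2; exists (realmx A) => //; exact/realmx_komlos.
Qed.

Lemma ler_Kc_K2 m n : Kc R m n <= 2 * K2 R (2 * m) n.
Proof.
(* The row count must read [m + m] to match the type of the stacked matrix. *)
rewrite mul2n -addnn; have [[C hC <-] _] := Kc_is_max m n.
pose X := map_mx (@complex.Re R) C; pose Y := map_mx (@complex.Im R) C.
have hA : komlos (col_mx X Y).
  apply/komlosE => j; rewrite big_split_ord/= -big_split/=.
  rewrite (le_trans _ ((ckomlosE C).1 hC j))// ler_sum// => i _.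
  by rewrite col_mxEu col_mxEd !mxE sqr_cmod.
have AK : cdisc (realmx (col_mx X Y)) <= K2 R (m + m) n.
  by rewrite -Vdisc2E; apply: (K2_is_max (m + m) n).2; exists (col_mx X Y).
(* A vector optimal for the stacked matrix serves as a competitor for [C]. *)
have [z hz zE] := cdisc_attained (realmx (col_mx X Y)).
apply: (@le_trans _ _ (2 * clinfnorm (realmx (col_mx X Y) *m z))); last first.
  by rewrite ler_wpM2l// -zE.
rewrite (le_trans (ler_cdisc C hz))//.
have CE : C = realmx X + Complex 0 1 *: realmx Y.
  by apply/matrixP => i j; rewrite !mxE; case: (C i j) => x y;
    rewrite /real_complex_def; simpc.
apply: clinfnorm_leP => [|i]; first by rewrite mulr_ge0// clinfnorm_ge0.
rewrite {1}CE mulmxDl -scalemxAl mxE (le_trans (ler_cmodD _ _))//.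
(* The factor [Complex 0 1] is the imaginary unit, of modulus 1, so what remains are the moduli of
   entries [i] and [m + i] of the stacked product. *)
rewrite [X in _ + cmod X]mxE cmodM cmodE expr0n expr1n add0r sqrtr1 mul1r.
rewrite mulrDl mul1r.
have := ler_clinfnorm (realmx (col_mx X Y) *m z).
rewrite /realmx map_col_mx mul_col_mx => h.
have := h (lshift m i); have := h (rshift m i).
rewrite col_mxEu col_mxEd => h1 h2.
exact: lerD.
Qed.

End ComplexKomlos.

Theorem proposition1p2 (R : realType) (m n : nat)
    (hm : (0 < m)%N) (hn : (0 < n)%N) :
  (forall A : 'M[R]_(m, n), is_min (Vdisc2_values A) (Vdisc2 A)) /\
  (forall A : 'M[R]_(2 * m, n), is_min (Vdisc2_values A) (Vdisc2 A)) /\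
  (forall C : 'M[R[i]]_(m, n), is_min (cdisc_values C) (cdisc C)) /\
  is_max (K2_values R m n) (K2 R m n) /\
  is_max (K2_values R (2 * m) n) (K2 R (2 * m) n) /\
  is_max (Kc_values R m n) (Kc R m n) /\
  K2 R m n <= Kc R m n /\
  Kc R m n <= 2 * K2 R (2 * m) n.
Proof.
split; first by move=> A; exact: Vdisc2_is_min.
split; first by move=> A; exact: Vdisc2_is_min.
split; first by move=> C; exact: cdisc_is_min.
split; first exact: K2_is_max.
split; first exact: K2_is_max.
split; first exact: Kc_is_max.
split; [exact: ler_K2_Kc|exact: ler_Kc_K2].
Qed.
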